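(* Let $k\ge1$. The probability mass function $h_r^{(I)}(n)=P(T_{r,k}^{(I)}=n)$ satisfies, for $r\ge1$ and $n\ge1$, the recursive scheme $$h_{r}^{(I)}(n)=h_{r}^{(I)}(n-1)-p^{k}q\,h_{r}^{(I)}(n-k-1)+p^{k}h_{r-1}^{(I)}(n-k)-p^{k+1}h_{r-1}^{(I)}(n-k-1),$$ with initial conditions $h_{0}^{(I)}(n)=\delta_{n,0}$.
   Context: $(X_i)_{i\ge1}$ is an infinite sequence of independent Bernoulli trials with $P(X_i=1)=p$, $0<p<1$, and $P(X_i=0)=q=1-p$. $T_{r,k}^{(I)}$ is the waiting time (number of trials) until the $r$-th occurrence of a success run of length $k$ under non-overlapping counting (each time $k$ consecutive ones are completed, a run is counted and counting starts anew from scratch): $T_{0,k}^{(I)}=0$ and $T_{r,k}^{(I)}=\min\{n\ge T_{r-1,k}^{(I)}+k: X_{n-k+1}=\cdots=X_n=1\}$ for $r\ge1$. Conventions: $h_r^{(I)}(n)=0$ for $n<0$; $\delta_{n,0}$ is the Kronecker delta. *)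

(* Defs.v *)
From HB Require Import structures.
From mathcomp Require Import all_boot all_order all_algebra finmap.
From mathcomp Require Import all_classical all_reals all_analysis.

Set Implicit Arguments.
Unset Strict Implicit.
Unset Printing Implicit Defensive.

Import Order.TTheory GRing.Theory Num.Theory.

Local Open Scope classical_set_scope.
Local Open Scope ring_scope.

(* Product rule over every finite subfamily of the indices in [I]. *)
Definition mutually_independent (K : choiceType) (d d' : measure_display)
    (T : measurableType d) (T' : measurableType d') (R : realType)
    (P : probability T R) (I : set K) (X : K -> {RV P >-> T'}) : Prop :=
  forall J : {fset K}, [set` J] `<=` I ->
  forall A : K -> set T', (forall i, i \in J -> measurable (A i)) ->
    P (\bigcap_(i in [set` J]) (X i @^-1` A i)) =
    (\prod_(i <- J) P (X i @^-1` A i))%E.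

(* Trials are indexed from 1: [X 0] is never looked at. Success is [true]. *)
Definition bernoulli_trials (d : measure_display) (T : measurableType d)
    (R : realType) (P : probability T R) (p : R)
    (X : nat -> {RV P >-> bool}) : Prop :=
  mutually_independent [set i | (1 <= i)%N] X /\
  forall i, (1 <= i)%N ->
    distribution P (X i) = bernoulli_prob p :> (set bool -> \bar R).

(* [None] stands for the minimum of the empty set, i.e. +oo. *)
Definition min_nat (S : set nat) : option nat :=
  if pselect (exists n, `[< S n >]) is left ex then Some (ex_minn ex) else None.

(* The outcomes x_(n-k+1), ..., x_n are all successes. The subtraction [n - k]
   is truncated; below it is only used with [k <= n]. *)
Definition success_window (k : nat) (x : nat -> bool) (n : nat) : Prop :=
  forall i, (n - k < i <= n)%N -> x i = true.

(* Waiting time for the [r]-th non-overlapping success run of length [k] in the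
   outcome sequence [x]; [None] if there are fewer than [r] such runs. *)
Fixpoint waiting_time (k : nat) (x : nat -> bool) (r : nat) : option nat :=
  if r is r'.+1 then
    if waiting_time k x r' is Some m then
      min_nat [set n | (m + k <= n)%N /\ success_window k x n]
    else None
  else Some 0%N.

(* The mass function n |-> P(T_(r,k) = n), on all of int so that the arguments
   n - k - 1 of the recursion make sense; it vanishes at negative integers. *)
Definition waiting_pmf (d : measure_display) (T : measurableType d)
    (R : realType) (P : probability T R) (X : nat -> {RV P >-> bool})
    (k r : nat) (n : int) : R :=
  match n with
  | Posz m => fine (P [set w | waiting_time k (fun i => X i w) r = Some m])
  | Negz _ => 0
  end.

(* Main.v *)
(** Write T_r for the waiting time. A run completing T_{r+1} at trial n occupies
    the trials n-k+1, ..., n; either T_r = n-k, or T_r <= n-k-1 < T_{r+1} and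
    trial n-k is a failure. Both conditions on the past are independent of the
    trials involved afterwards, so
      h_{r+1}(n) = p^k h_r(n-k) + p^k q g_r(n-k-1),
    where g_r(m) = P(T_r <= m < T_{r+1}). Since
      g_r(m) - g_r(m-1) = h_r(m) - h_{r+1}(m),
    subtracting the identities at n and n-1 gives the recursion. *)

Require Import Defs.
From HB Require Import structures.
From mathcomp Require Import all_boot all_order all_algebra finmap.
From mathcomp Require Import all_classical all_reals all_analysis.
From mathcomp Require Import zify ring.

Import Order.TTheory GRing.Theory Num.Theory.

Local Open Scope classical_set_scope.
Local Open Scope ring_scope.

(** * Waiting times as minima *)

Lemma min_natP (S : set nat) (n : nat) :
  min_nat S = Some n <-> S n /\ forall j, S j -> (n <= j)%N.
Proof.
rewrite /min_nat; case: pselect => [ex|nex].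
  case: ex_minnP => m /asboolP Sm minm; split=> [[<-]|[Sn minn]].
    by split=> // j Sj; apply: minm; apply/asboolP.
  congr Some; apply/eqP; rewrite eqn_leq minn // andbT.
  by apply: minm; apply/asboolP.
by split=> // -[Sn _]; case: nex; exists n; apply/asboolP.
Qed.

Lemma waiting_timeSP (k : nat) (x : nat -> bool) (r n : nat) :
  waiting_time k x r.+1 = Some n <->
  exists m, [/\ waiting_time k x r = Some m, (m + k <= n)%N,
    success_window k x n &
    forall j, (m + k <= j)%N -> success_window k x j -> (n <= j)%N].
Proof.
rewrite /=; case: (waiting_time k x r) => [m|]; last by split=> // -[m []].
split=> [/min_natP[[mn Wn] minn]|[_ [[<-] mn Wn minn]]].
  by exists m; split=> // j mj Wj; apply: minn.
by apply/min_natP; split=> // j [mj Wj]; apply: minn.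
Qed.

(** The stopping-time property: by induction on [r], both the window ending at [n] and every earlier
    competing window lie within trials 1 to [n]. *)
Lemma waiting_time_dep (k : nat) (x y : nat -> bool) (r n : nat) :
  (forall i, (1 <= i <= n)%N -> x i = y i) ->
  waiting_time k x r = Some n -> waiting_time k y r = Some n.
Proof.
elim: r n => [|r IHr] n xy // /waiting_timeSP[m [xm mn Wn minn]].
apply/waiting_timeSP; exists m; split => //.
- by apply: IHr xm => i im; apply: xy; lia.
- by move=> i ni; rewrite -xy; [apply: Wn|lia].
- move=> j mj Wj; have [//|jn] := leqP n j.
  suff : (n <= j)%N by lia.
  by apply: minn => // i ij; rewrite xy; [exact: Wj|lia].
Qed.

(** * Sets of sequences depending on finitely many trials *)

Definition waits_at (k r m : nat) : set (nat -> bool) :=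
  [set x | waiting_time k x r = Some m].

Definition waits_by (k r m : nat) : set (nat -> bool) :=
  [set x | exists2 a, (a <= m)%N & waiting_time k x r = Some a].

Definition cylinder (m : nat) (t : seq bool) : set (nat -> bool) :=
  [set x | forall i, (i < size t)%N -> x (m + i.+1)%N = nth true t i].

(** Stands for membership in the sigma-algebra of trials 1 to [m]. One implication suffices,
    agreement of [x] and [y] being symmetric. *)
Definition determined_by (m : nat) (E : set (nat -> bool)) : Prop :=
  forall x y, (forall i, (1 <= i <= m)%N -> x i = y i) -> E x -> E y.

Lemma cylinder_cons (m : nat) (b : bool) (t : seq bool) :
  cylinder m (b :: t) = [set x | x m.+1 = b] `&` cylinder m.+1 t.
Proof.
apply/seteqP; split=> x /=.
  move=> Cx; split=> [|i it]; first by rewrite -addn1 (Cx 0%N).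
  by rewrite addSnnS; exact: (Cx i.+1).
by move=> [xb Cx] [|i] it; rewrite ?addn1 //= -addSnnS; exact: Cx.
Qed.

Lemma cylinder_nseq_true (k m : nat) :
  cylinder m (nseq k true) = [set x | success_window k x (m + k)].
Proof.
apply/seteqP; split=> x /= Hx.
  move=> i mi; have -> : i = (m + (i - m.+1).+1)%N by lia.
  by rewrite Hx ?size_nseq ?nth_nseq; [case: ifP|lia].
move=> i; rewrite size_nseq nth_nseq => ik; rewrite ik.
by apply: Hx; lia.
Qed.

Lemma determined_byW (m n : nat) (E : set (nat -> bool)) :
  (m <= n)%N -> determined_by m E -> determined_by n E.
Proof. by move=> mn Em x y xy; apply: Em => i im; apply: xy; lia. Qed.

Lemma determined_byI (m : nat) (E F : set (nat -> bool)) :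
  determined_by m E -> determined_by m F -> determined_by m (E `&` F).
Proof. by move=> Em Fm x y xy [Ex Fx]; split; [exact: Em Ex|exact: Fm Fx]. Qed.

Lemma determined_byD (m : nat) (E F : set (nat -> bool)) :
  determined_by m E -> determined_by m F -> determined_by m (E `\` F).
Proof.
move=> Em Fm x y xy [Ex nFx]; split; first exact: Em Ex.
by apply: contra_not nFx; apply: Fm => i im; rewrite xy.
Qed.

Lemma determined_by_cylinder (m : nat) (t : seq bool) :
  determined_by (m + size t) (cylinder m t).
Proof. by move=> x y xy Cx i it; rewrite -xy; [exact: Cx|lia]. Qed.

Lemma determined_by_waits_at (k r m : nat) : determined_by m (waits_at k r m).
Proof. by move=> x y xy; apply: waiting_time_dep. Qed.

Lemma determined_by_waits_by (k r m : nat) : determined_by m (waits_by k r m).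
Proof.
move=> x y xy [a am xa]; exists a => //.
by apply: waiting_time_dep xa => i ia; apply: xy; lia.
Qed.

(** The section of [E] at trial [i]: overwriting that trial removes the dependence on it, which
    drives the inductions on the number of trials. *)
Definition fix_coord (i : nat) (b : bool) (E : set (nat -> bool)) :
  set (nat -> bool) := [set x | E (fun j => if j == i then b else x j)].

Lemma determined_by_fix_coord (m : nat) (b : bool) (E : set (nat -> bool)) :
  determined_by m.+1 E -> determined_by m (fix_coord m.+1 b E).
Proof.
move=> Em x y xy; apply: Em => i im; case: eqVneq => // neq.
by apply: xy; lia.
Qed.

Lemma fix_coord_split (i : nat) (E : set (nat -> bool)) :
  E = (fix_coord i true E `&` [set x | x i = true]) `|`
      (fix_coord i false E `&` [set x | x i = false]).
Proof.
have xE b (x : nat -> bool) : x i = b ->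
    (fun j => if j == i then b else x j) = x.
  by move=> xi; apply/funext => j; case: eqVneq => [->|].
apply/seteqP; split=> x; rewrite /fix_coord /=.
  by move=> Ex; case xi: (x i); [left|right]; split; rewrite ?(xE _ _ xi).
by move=> [] [+ xi]; rewrite (xE _ _ xi).
Qed.

(** * Decomposition by the last completed run *)

Lemma waits_by0 (k r : nat) : waits_by k r 0 = waits_at k r 0.
Proof.
apply/seteqP; split=> x /=; last by exists 0%N.
by move=> [a]; rewrite leqn0 => /eqP ->.
Qed.

Lemma waits_byS (k r m : nat) :
  waits_by k r m.+1 = waits_by k r m `|` waits_at k r m.+1.
Proof.
apply/seteqP; split=> x /=.
  move=> [a]; rewrite leq_eqVlt => /predU1P[->|am] xa; first by right.
  by left; exists a.
by move=> [[a am xa]|xm]; [exists a => //; lia|exists m.+1].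
Qed.

Lemma waits_by_atS (k r m : nat) : waits_by k r m `&` waits_at k r m.+1 = set0.
Proof.
apply/seteqP; split=> x //= [[a am +] xm].
by rewrite /waits_at /= in xm; rewrite xm => -[]; lia.
Qed.

Lemma waits_by_subset (k r m : nat) : waits_by k r.+1 m `<=` waits_by k r m.
Proof.
by move=> x [a am /waiting_timeSP[b [xb ba _ _]]]; exists b => //; lia.
Qed.

Lemma waits_at_lt (k r n : nat) : (n < k)%N -> waits_at k r.+1 n = set0.
Proof.
by move=> nk; apply/seteqP; split=> x // /waiting_timeSP[m [_ + _ _]]; lia.
Qed.

Lemma success_windowW (k n : nat) (x : nat -> bool) (j : nat) :
  success_window k x n -> (n - k < j)%N -> (j <= n)%N -> x j = true.
Proof. by move=> W nj jn; apply: W; rewrite nj. Qed.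

(** The boundary case n = k: the run starts at trial 1, so no failure can precede it and T_r must be
    0. *)
Lemma waits_at_diag (k r : nat) : (1 <= k)%N ->
  waits_at k r.+1 k = waits_at k r 0 `&` cylinder 0 (nseq k true).
Proof.
move=> hk; rewrite cylinder_nseq_true; apply/seteqP; split=> x /=.
  move=> /waiting_timeSP[m [xm mk Wk _]]; split; last by rewrite add0n.
  by have m0 : m = 0%N by [lia]; rewrite m0 in xm.
move=> [x0]; rewrite add0n => Wk; apply/waiting_timeSP; exists 0%N.
by split=> // j; rewrite add0n.
Qed.

(** Taking n = m+1+k makes n-k-1 = [m] a natural number. The pieces correspond to T_r = m+1 and to
    T_r <= m; in the second, minimality of T_(r+1) is equivalent to a failure at trial m+1 and no
    further run completed by time [m]. *)
Lemma waits_at_split (k r m : nat) : (1 <= k)%N ->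
  waits_at k r.+1 (m.+1 + k) =
  (waits_at k r m.+1 `&` cylinder m.+1 (nseq k true)) `|`
  ((waits_by k r m `\` waits_by k r.+1 m) `&`
   cylinder m (false :: nseq k true)).
Proof.
move=> hk; rewrite cylinder_cons cylinder_nseq_true; apply/seteqP; split=> x /=.
  move=> /waiting_timeSP[a [xa am Wm minm]].
  have [aE|neq] := eqVneq a m.+1; first by left; split=> //; rewrite -aE.
  right; split; last split=> //.
    split; first by exists a => //; lia.
    move=> [b bm /waiting_timeSP[a' []]]; rewrite xa => -[<-] ab Wb _.
    by have := minm b ab Wb; lia.
  (* A success at trial m+1 would shift the run one step back, completing it at m+k >= a+k, before
     the minimum. *)
  case xm : (x m.+1) => //.
  suff : (m.+1 + k <= m + k)%N by lia.
  apply: minm; first by lia.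
  move=> i im; have [->//|neqi] := eqVneq i m.+1.
  by apply: success_windowW Wm _ _; lia.
move=> [[xm Wm]|[[[a am xa] nby] [xm Wm]]].
  by apply/waiting_timeSP; exists m.+1; split.
apply/waiting_timeSP; exists a; split=> //; first by lia.
suff minm n j : (j <= n)%N -> (a + k <= j)%N -> success_window k x j ->
    (m.+1 + k <= j)%N by move=> j; exact: minm.
(* Strong induction on [j]: a run completed by time [m] would make the least
   such [j] the (r+1)-st waiting time. *)
elim: n j => [|n IHn] j jn aj Wj; first by lia.
have [//|jm] := leqP (m.+1 + k) j.
(* If m < j < m+1+k, the window ending at [j] contains the failed trial m+1. *)
have [mj|jm'] := ltnP m j.
  by move: (Wj m.+1); rewrite xm => W; have := W ltac:(lia).
case: nby; exists j => //; apply/waiting_timeSP; exists a.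
split=> // j' aj' Wj'.
have [//|jj'] := leqP j j'.
by have := IHn j' ltac:(lia) aj' Wj'; lia.
Qed.

(** * Measurability and additivity *)

Section BernoulliTrials.
Context {d : measure_display} {T : measurableType d} {R : realType}.
Context {P : probability T R} (X : nat -> {RV P >-> bool}).

Definition event (E : set (nat -> bool)) : set T :=
  [set w | E (fun i => X i w)].
(** The law of the trial sequence, as a real-valued function on sets of sequences. *)
Definition Pr (E : set (nat -> bool)) : R := fine (P (event E)).

(** Induction on [m], splitting on the value of the last trial; a set depending on no trial is empty
    or full. *)
Lemma measurable_event (m : nat) (E : set (nat -> bool)) :
  determined_by m E -> measurable (event E).
Proof.
elim: m E => [|m IHm] E Em.
  have [[x Ex]|nE] := pselect (E !=set0).
    have -> : event E = setT; last exact: measurableT.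
    by apply/seteqP; split=> w // _; apply: Em Ex => i; lia.
  have -> : event E = set0; last exact: measurable0.
  by apply/seteqP; split=> w // Ew; case: nE; exists (fun i => X i w).
have coordE b : measurable (event [set x | x m.+1 = b]).
  exact: (@measurable_funPTI _ _ _ _ (X m.+1) [set b]).
rewrite (fix_coord_split m.+1 E).
have fixE b : measurable (event (fix_coord m.+1 b E)).
  by apply: IHm; exact: determined_by_fix_coord.
exact: measurableU (measurableI _ _ (fixE true) (coordE true))
  (measurableI _ _ (fixE false) (coordE false)).
Qed.

Lemma PrU (m : nat) (E F : set (nat -> bool)) :
  determined_by m E -> determined_by m F -> E `&` F = set0 ->
  Pr (E `|` F) = Pr E + Pr F.
Proof.
move=> Em Fm EF; have mE := measurable_event _ _ Em.
have mF := measurable_event _ _ Fm.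
rewrite /Pr -fineD ?fin_num_measure // -measureU //.
by have := congr1 event EF.
Qed.

Lemma Pr0 : Pr set0 = 0.
Proof. by rewrite /Pr (_ : event set0 = set0) ?measure0. Qed.

Lemma PrD (m : nat) (E F : set (nat -> bool)) :
  determined_by m E -> determined_by m F -> F `<=` E ->
  Pr (E `\` F) = Pr E - Pr F.
Proof.
move=> Em Fm FE; apply/eqP; rewrite eq_sym subr_eq; apply/eqP.
rewrite -[in LHS](setDUK FE) addrC (@PrU m) ?setDIK //.
exact: determined_byD.
Qed.

(* The function g_r of the header. *)
Definition waiting_gap (k r : nat) (n : int) : R :=
  if n is Posz m then Pr (waits_by k r m) - Pr (waits_by k r.+1 m) else 0.

Lemma waiting_pmfE (k r m : nat) : waiting_pmf X k r m%:Z = Pr (waits_at k r m).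
Proof. by []. Qed.

(** {T_s <= n} is the disjoint union of {T_s <= n-1} and {T_s = n}; apply this with s = r and s =
    r+1. At n = 0 the value 0 of the gap at -1 is the right one. *)
Lemma waiting_gap_diff (k r : nat) (n : int) :
  waiting_gap k r n - waiting_gap k r (n - 1) =
  waiting_pmf X k r n - waiting_pmf X k r.+1 n.
Proof.
case: n => [[|m]|m]; last by rewrite /= !subr0.
  by rewrite /= !waits_by0 subr0.
have -> : m.+1%:Z - 1 = m%:Z :> int by lia.
have byS s :
    Pr (waits_by k s m.+1) = Pr (waits_by k s m) + Pr (waits_at k s m.+1).
  rewrite waits_byS (@PrU m.+1) //; last exact: waits_by_atS.
    by apply: (@determined_byW m) => //; exact: determined_by_waits_by.
  exact: determined_by_waits_at.
rewrite /waiting_gap !byS !waiting_pmfE; ring.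
Qed.

(** * Independence of past and future trials *)

Context (p : R).
Hypothesis p01 : 0 < p < 1.
Hypothesis hX : bernoulli_trials p X.

Lemma prob_coord (i : nat) (b : bool) :
  (1 <= i)%N -> P (X i @^-1` [set b]) = (bernoulli_pmf p b)%:E.
Proof.
move=> i1; have := congr1 (@^~ [set b]) (hX.2 i i1).
rewrite /distribution /pushforward => ->.
(* [bernoulli_prob] is guarded by the weak inequalities. *)
have p01W : 0 <= p <= 1 by case/andP: p01 => p0 p1; rewrite !ltW.
by rewrite /bernoulli_prob p01W fsbig_set1.
Qed.

(** The product rule for the index set {1, ..., [size t]}; mutual independence enters here. Trials
    count from 1 and entries of [t] from 0, hence [i.-1]. *)
Lemma Pr_cylinder0 (t : seq bool) :
  Pr (cylinder 0 t) = \prod_(b <- t) bernoulli_pmf p b.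
Proof.
pose J := [fset i in iota 1 (size t)]%fset.
pose A i : set bool := [set nth true t i.-1].
have JE i : (i \in J) = (1 <= i <= size t)%N.
  by rewrite !inE mem_iota add1n ltnS.
have -> : Pr (cylinder 0 t) =
    fine (P (\bigcap_(i in [set` J]) (X i @^-1` A i))).
  congr (fine (P _)); apply/seteqP; split=> w /=.
    by move=> Cw [|i]; rewrite /= JE => // /andP[_ it]; exact: Cw.
  by move=> Aw i it; have := Aw i.+1; rewrite /= JE; apply.
rewrite hX.1 //; last by move=> i; rewrite /= JE => /andP[].
have -> : (\prod_(i <- J) P (X i @^-1` A i))%E =
    (\prod_(i <- iota 1 (size t)) (bernoulli_pmf p (nth true t i.-1))%:E)%E.
  have pJ : perm_eq J (iota 1 (size t)).
    apply: uniq_perm; rewrite ?fset_uniq ?iota_uniq // => i.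
    by rewrite JE mem_iota add1n ltnS.
  rewrite (perm_big _ pJ) [LHS]big_seq [RHS]big_seq; apply: eq_bigr => i.
  by rewrite mem_iota => /andP[i1 _]; exact: prob_coord.
rewrite prodEFin /= (iotaDl 1 0) big_map (big_nth true) big_mkord.
by rewrite -(big_mkord xpredT (fun i => bernoulli_pmf p (nth true t i)))
  /index_iota subn0.
Qed.

(** Induction on [m] with [t] general: after splitting [E] on trial m+1, the value [b] of that trial
    joins the block, giving [b :: t] starting after trial [m] and a section of [E] determined by the
    first [m] trials. *)
Lemma Pr_indep_cylinder (m : nat) (E : set (nat -> bool)) (t : seq bool) :
  determined_by m E ->
  Pr (E `&` cylinder m t) = Pr E * \prod_(b <- t) bernoulli_pmf p b.
Proof.
elim: m E t => [|m IHm] E t Em.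
  have [[x Ex]|nE] := pselect (E !=set0).
    have -> : E = setT.
      by apply/seteqP; split=> y // _; apply: Em Ex => i; lia.
    rewrite setTI Pr_cylinder0.
    by rewrite /Pr (_ : event setT = setT) // probability_setT mul1r.
  have -> : E = set0.
    by apply/seteqP; split=> y //= Ey; case: nE; exists y.
  by rewrite set0I Pr0 mul0r.
have EbC b : determined_by m.+1 (fix_coord m.+1 b E `&` [set x | x m.+1 = b]).
  apply: determined_byI => [|x y xy /= <-]; last by rewrite xy ?leqnn.
  by apply: (@determined_byW m) => //; exact: determined_by_fix_coord.
have disj (F G : set (nat -> bool)) :
    (F `&` [set x | x m.+1 = true]) `&` (G `&` [set x | x m.+1 = false]) = set0.
  by apply/seteqP; split=> x // [[_ /= ->] []].
have PrE b s :
    Pr (fix_coord m.+1 b E `&` [set x | x m.+1 = b] `&` cylinder m.+1 s) =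
    Pr (fix_coord m.+1 b E) *
    (bernoulli_pmf p b * \prod_(c <- s) bernoulli_pmf p c).
  rewrite -setIA -cylinder_cons IHm ?big_cons //.
  exact: determined_by_fix_coord.
have split s : Pr (E `&` cylinder m.+1 s) =
    \sum_(b <- [:: true; false]) Pr (fix_coord m.+1 b E) *
    (bernoulli_pmf p b * \prod_(c <- s) bernoulli_pmf p c).
  rewrite !big_cons big_nil addr0 -!PrE -(@PrU (m.+1 + size s)).
  - by rewrite -setIUl -fix_coord_split.
  - apply: determined_byI; last exact: determined_by_cylinder.
    exact: determined_byW (leq_addr _ _) (EbC _).
  - apply: determined_byI; last exact: determined_by_cylinder.
    exact: determined_byW (leq_addr _ _) (EbC _).
  - by apply/seteqP; split=> x // [[[_ /= ->] _] [[]]].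
(* The empty block expands [Pr E] itself over the two sections; comparison with the expansion for
   [t] gives the factorization. *)
have := split [::]; rewrite (_ : cylinder m.+1 [::] = setT); last first.
  by apply/seteqP; split=> x.
rewrite setIT split !big_cons !big_nil => ->; ring.
Qed.

(** * The identity relating h_(r+1) to h_r and g_r *)

Lemma prod_bernoulli_pmf_nseq (k : nat) :
  \prod_(b <- nseq k true) bernoulli_pmf p b = p ^+ k.
Proof. by rewrite big_nseq iter_mulr_1. Qed.

Lemma Pr_waits_at_diag (k r : nat) : (1 <= k)%N ->
  Pr (waits_at k r.+1 k) = p ^+ k * Pr (waits_at k r 0).
Proof.
move=> hk; rewrite waits_at_diag // Pr_indep_cylinder.
  by rewrite prod_bernoulli_pmf_nseq mulrC.
exact: determined_by_waits_at.
Qed.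

(** Both pieces of [waits_at_split] factor into past times block; the blocks have weights p^k and q
    p^k. *)
Lemma Pr_waits_atS (k r m : nat) : (1 <= k)%N ->
  Pr (waits_at k r.+1 (m.+1 + k)) = p ^+ k * Pr (waits_at k r m.+1) +
    p ^+ k * (1 - p) * (Pr (waits_by k r m) - Pr (waits_by k r.+1 m)).
Proof.
move=> hk; rewrite waits_at_split // (@PrU (m.+1 + k)).
- rewrite !Pr_indep_cylinder ?(@PrD m).
  + by rewrite big_cons !prod_bernoulli_pmf_nseq /=; ring.
  + exact: determined_by_waits_by.
  + exact: determined_by_waits_by.
  + exact: waits_by_subset.
  + by apply: determined_byD; exact: determined_by_waits_by.
  + exact: determined_by_waits_at.
- apply: determined_byI.
    by apply: (@determined_byW m.+1); [lia|exact: determined_by_waits_at].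
  by apply: (@determined_byW (m.+1 + size (nseq k true)));
    [rewrite size_nseq|exact: determined_by_cylinder].
- apply: determined_byI.
    apply: (@determined_byW m); first by lia.
    by apply: determined_byD; exact: determined_by_waits_by.
  by apply: (@determined_byW (m + size (false :: nseq k true)));
    [rewrite /= size_nseq; lia|exact: determined_by_cylinder].
(* Disjointness: T_r cannot be both m+1 and some a <= m. *)
- apply/seteqP; split=> x //= [[xm _] [[[a am xa] _] _]].
  by rewrite /waits_at /= xa in xm; case: xm; lia.
Qed.

(** Stated for all integers so that it also applies at n-1. For n < k every term vanishes; at n = k
    the gap is taken at -1 and is 0; n > k is [Pr_waits_atS]. *)
Lemma waiting_pmf_first_run (k r : nat) (n : int) : (1 <= k)%N ->
  waiting_pmf X k r.+1 n = p ^+ k * waiting_pmf X k r (n - k%:Z) +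
    p ^+ k * (1 - p) * waiting_gap k r (n - k%:Z - 1).
Proof.
have neg s (m : int) : m < 0 -> waiting_pmf X k s m = 0 by case: m.
have gneg (m : int) : m < 0 -> waiting_gap k r m = 0 by case: m.
move=> hk; case: (ltrP n 0) => [n0|].
  by rewrite !neg ?gneg ?mulr0 ?addr0 //; lia.
case: n => // n _; case: (ltngtP n k) => [nk|kn|->].
- by rewrite waiting_pmfE waits_at_lt // Pr0 neg ?gneg ?mulr0 ?addr0 //; lia.
- have [m ->] : exists m, n = (m.+1 + k)%N by exists (n - k.+1)%N; lia.
  have -> : (m.+1 + k)%N%:Z - k%:Z = m.+1%:Z by lia.
  have -> : m.+1%:Z - 1 = m%:Z :> int by lia.
  by rewrite !waiting_pmfE Pr_waits_atS.
- rewrite subrr waiting_pmfE gneg // mulr0 addr0.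
  exact: Pr_waits_at_diag.
Qed.

End BernoulliTrials.

Theorem theorem3p1 (d : measure_display) (T : measurableType d) (R : realType)
    (P : probability T R) (p : R) (X : nat -> {RV P >-> bool}) (k : nat)
    (hp : 0 < p < 1) (hX : bernoulli_trials p X) (hk : (1 <= k)%N) :
  let q := 1 - p in
  let h := waiting_pmf X k in
  (forall n : int, h 0%N n = (n == 0)%:R) /\
  (forall (r : nat) (n : int), (1 <= r)%N -> 1 <= n ->
    h r n = h r (n - 1)
            - p ^+ k * q * h r (n - k%:Z - 1)
            + p ^+ k * h (r - 1)%N (n - k%:Z)
            - p ^+ k.+1 * h (r - 1)%N (n - k%:Z - 1)).
Proof.
move=> q h; split=> [[[|m]|m] //|[//|r] n _ _].
- rewrite /h /= (_ : [set w | _] = setT) ?probability_setT //.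
  by apply/seteqP; split.
- rewrite /h /= (_ : [set w | _] = set0) ?measure0 //.
  by apply/seteqP; split=> w // -[].
rewrite subn1 /= /h.
have Hn := waiting_pmf_first_run X p hp hX k r n hk.
have := waiting_pmf_first_run X p hp hX k r (n - 1) hk.
rewrite (_ : n - 1 - k%:Z = n - k%:Z - 1); last by lia.
move=> Hn1; have := waiting_gap_diff X k r (n - k%:Z - 1).
(* Eliminating g_r(n-k-1) cancels the remaining g_r(n-k-2); the coefficients of h_r(n-k-1), with [r]
   the predecessor index, add up to -p^k + p^k q = -p^(k+1). *)
move=> /(canRL (subrK _)) gapE; rewrite {}Hn {}Hn1 {}gapE /q exprS; ring.
Qed.
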